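(* Fix a prime power $q=p^e$ ($p$ prime) and an integer $\ell\geq1$. For $m\geq5$ put $s_m=\lfloor(m-3)/2\rfloor$. Then $$\left\lceil\frac{\genfrac{[}{]}{0pt}{}{\ell m}{s_m}_{q}}{em\,|\operatorname{GL}(2\ell,\mathbb{F}_{q^m})|}\right\rceil\longrightarrow\infty\qquad\text{as } m\to\infty.$$ Hence, for any choice for each $m\geq5$ of a maximum scattered $q$-system $W_m\leq\mathbb{F}_{q^m}^{2\ell}$, the number of pairwise inequivalent extremal $(m-3)$-scattered $q$-systems among the systems $U_\varphi$ constructed from $W=W_m$ with $s=s_m$ (see context) and satisfying $\dim_{\mathbb{F}_q}\overline E_Z=s_m$ tends to infinity as $m\to\infty$.
   Context: The Gaussian coefficient is $\genfrac{[}{]}{0pt}{}{N}{s}_{q}=\prod_{i=0}^{s-1}\frac{q^{N-i}-1}{q^{s-i}-1}$. Write $F=\mathbb{F}_{q^m}$. Systems. An $[n,k]_{q^m/q}$ $q$-system is an $n$-dimensional $\mathbb{F}_q$-subspace $U\leq F^k$ with $\langle U\rangle_F=F^k$; $n$ is its rank. It is $h$-scattered if $\dim_{\mathbb{F}_q}(U\cap H)\leq h$ for every $h$-dimensional $F$-subspace $H\leq F^k$; an $h$-scattered system is extremal if $n=\lfloor km/(h+1)\rfloor$. A maximum scattered system in $F^{2\ell}$ is a $1$-scattered $q$-system of rank $\ell m$ (such systems exist for every $m>1$). Two systems $U,U'$ in $F^k$ are equivalent if $U'=B(\sigma(U))$ for some $B\in\operatorname{GL}(k,F)$ and $\sigma\in\operatorname{Aut}(F)$,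 the full field automorphism group of $F$ (of order $em$). Construction. Put $n_0=\ell m$, $k_0=\ell(m-2)$. Choose an ordered $\mathbb{F}_q$-basis of $W$ as the columns of $H_0\in F^{2\ell\times n_0}$, let $D_0$ be the $F$-row space of $H_0$, choose a generator matrix $G_0\in F^{k_0\times n_0}$ of $D_0^\perp=\{y\in F^{n_0}:xy^\top=0\ \forall x\in D_0\}$ with columns $g_1,\ldots,g_{n_0}$ (these are $\mathbb{F}_q$-independent), and let $U_0\leq F^{k_0}$ be their $\mathbb{F}_q$-span. For an $\mathbb{F}_q$-linear map $\varphi:U_0\to F^s$ define $$U_\varphi=\{(u,\varphi(u)+a):u\in U_0,\ a\in\mathbb{F}_q^s\}\leq F^{k_0+s},$$ $\Phi=[\varphi(g_1)\ \cdots\ \varphi(g_{n_0})]\in F^{s\times n_0}$, and $Z=-H_0\Phi^\top\in F^{2\ell\times s}$. If $z_1,\ldots,z_s$ are the columns of $Z$, put $\overline E_Z=\langle z_1+W,\ldots,z_s+W\rangle_{\mathbb{F}_q}\leq F^{2\ell}/W$. *)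

(* Defs.v *)
From HB Require Import structures.
From mathcomp Require Import all_boot all_order all_algebra all_fingroup all_field.

Set Implicit Arguments.
Unset Strict Implicit.
Unset Printing Implicit Defensive.

Import Order.TTheory GRing.Theory Num.Theory.
Local Open Scope ring_scope.

Definition gauss_binomial (q N s : nat) : rat :=
  \prod_(i < s) (((q ^ (N - i))%:R - 1) / ((q ^ (s - i))%:R - 1)).

Definition s_ (m : nat) : nat := (m - 3) %/ 2.

Definition tends_to_infty (u : nat -> int) : Prop :=
  forall B : int, exists m0 : nat, forall m : nat, (m0 <= m)%N -> B <= u m.

(* Vectors of F^k are finite functions 'I_k -> F: this type carries a          *)
(* vectType structure over the small field Fq, so F_q-subspaces of F^k are     *)
(* terms of type {vspace {ffun 'I_k -> F}}.  F-subspaces of F^k are row spaces *)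
(* of matrices over F, as everywhere in mxalgebra.                             *)
Section Systems.
Variables (Fq : finFieldType) (F : fieldExtType Fq).

Definition rowf k (v : {ffun 'I_k -> F}) : 'rV[F]_k := \row_i v i.
Definition colf k (v : {ffun 'I_k -> F}) : 'cV[F]_k := \col_i v i.
Definition col_vec k n (A : 'M[F]_(k, n)) (j : 'I_n) : {ffun 'I_k -> F} :=
  [ffun i => A i j].

(* The row space is the F-span of U. *)
Definition Fspan k (U : {vspace {ffun 'I_k -> F}}) : 'M[F]_(\dim U, k) :=
  \matrix_(i < \dim U) rowf (vbasis U)`_i.

(* The row space of H, seen as an F_q-subspace of F^k; see mem_restr. *)
Definition restr r k (H : 'M[F]_(r, k)) : {vspace {ffun 'I_k -> F}} :=
  span [seq [ffun j => b * H i j] | b <- vbasis {:F}, i <- enum 'I_r].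

Lemma mem_restr r k (H : 'M[F]_(r, k)) (v : {ffun 'I_k -> F}) :
  (v \in restr H) = (rowf v <= H)%MS.
Proof.
apply/idP/submxP => [vH | [x xH]].
  rewrite (@coord_span _ _ _ (in_tuple _) _ vH).
  apply: (big_ind (fun v : {ffun 'I_k -> F} => exists D, rowf v = D *m H)).
  - by exists 0; rewrite mul0mx; apply/rowP => j; rewrite !mxE ffunE.
  - move=> u w [x ux] [y wy]; exists (x + y); rewrite mulmxDl -ux -wy.
    by apply/rowP => j; rewrite !mxE ffunE.
  move=> i _; set s := [seq _ | b <- _, i <- _].
  have /allpairsP[[b j] /= [_ _ ->]] : s`_i \in s.
    by rewrite mem_nth // ltn_ord.
  exists ((coord (in_tuple s) i v *: b) *: delta_mx 0 j).
  rewrite -scalemxAl -rowE; apply/rowP => l.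
  by rewrite !mxE !ffunE scalerAl.
have -> : v = \sum_i [ffun j => x 0 i * H i j].
  apply/ffunP => j; have := congr1 (fun M : 'rV_k => M 0 j) xH; rewrite !mxE => ->.
  by rewrite sum_ffunE; apply: eq_bigr => i _; rewrite ffunE.
apply: memv_suml => i _.
rewrite (coord_vbasis (memvf (x 0 i))).
have -> : [ffun j => (\sum_(l < \dim {:F})
    coord (vbasis {:F}) l (x 0 i) *: (vbasis {:F})`_l) * H i j]
  = \sum_(l < \dim {:F}) coord (vbasis {:F}) l (x 0 i) *:
      [ffun j => (vbasis {:F})`_l * H i j] :> {ffun 'I_k -> F}.
  apply/ffunP => j; rewrite ffunE sum_ffunE mulr_suml.
  by apply: eq_bigr => l _; rewrite !ffunE scalerAl.
apply: memv_suml => l _; apply: memvZ; apply: memv_span.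
apply/allpairsP; exists ((vbasis {:F})`_l, i); split => //=.
  by rewrite mem_nth // size_tuple.
by rewrite mem_enum.
Qed.

(* An [n, k]_{q^m/q} q-system, where F = F_{q^m}. *)
Definition qsystem n k (U : {vspace {ffun 'I_k -> F}}) : Prop :=
  \dim U = n /\ row_full (Fspan U).

Definition scattered h k (U : {vspace {ffun 'I_k -> F}}) : Prop :=
  forall H : 'M[F]_k, \rank H = h -> (\dim (U :&: restr H)%VS <= h)%N.

Definition extremal_scattered h k (U : {vspace {ffun 'I_k -> F}}) : Prop :=
  qsystem ((k * \dim {:F}) %/ h.+1)%N U /\ scattered h U.

Definition maximum_scattered l (W : {vspace {ffun 'I_(2 * l) -> F}}) : Prop :=
  qsystem (l * \dim {:F})%N W /\ scattered 1%N W.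

Definition equivalent k (U U' : {vspace {ffun 'I_k -> F}}) : Prop :=
  exists (B : 'M[F]_k) (sigma : {rmorphism F -> F}),
    [/\ B \in unitmx, bijective sigma
      & forall v, v \in U' <->
          exists2 u, u \in U & colf v = B *m map_mx sigma (colf u)].

Definition basis_matrix k n (W : {vspace {ffun 'I_k -> F}})
    (H0 : 'M[F]_(k, n)) : Prop :=
  basis_of W [seq col_vec H0 j | j <- enum 'I_n].

(* G generates the dual of the row space of H. *)
Definition dual_generator r k n (H : 'M[F]_(r, n)) (G : 'M[F]_(k, n)) : Prop :=
  row_free G /\
  forall y : 'rV[F]_n,
    (y <= G)%MS <-> (forall x : 'rV[F]_n, (x <= H)%MS -> x *m y^T = 0).

Definition colspan k n (G : 'M[F]_(k, n)) : {vspace {ffun 'I_k -> F}} :=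
  span [seq col_vec G j | j <- enum 'I_n].

Section Construction.
Variables (k0 s n0 : nat) (G0 : 'M[F]_(k0, n0)).
Let U0 := colspan G0.
Variable phi : 'Hom(subvs_of U0, {ffun 'I_s -> F}).

Definition Uphi_map (x : subvs_of U0 * {ffun 'I_s -> Fq^o}) :
    {ffun 'I_(k0 + s) -> F} :=
  [ffun i => match split i with
             | inl j => vsval x.1 j
             | inr j => phi x.1 j + (x.2 j)%:A
             end].

Fact Uphi_map_linear : linear Uphi_map.
Proof.
move=> c [u a] [w b]; apply/ffunP => i; rewrite !ffunE /=.
case: (split i) => j; rewrite ?linearP !ffunE //.
by rewrite scalerDr scalerDl scalerA addrACA.
Qed.

HB.instance Definition _ :=
  GRing.isLinear.Build Fq _ _ _ Uphi_map Uphi_map_linear.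

Definition Uphi : {vspace {ffun 'I_(k0 + s) -> F}} := limg (linfun Uphi_map).

Lemma mem_Uphi v :
  v \in Uphi <-> exists (u : subvs_of U0) (a : {ffun 'I_s -> Fq}),
    (forall j, v (lshift s j) = vsval u j) /\
    (forall j, v (rshift k0 j) = phi u j + (a j)%:A).
Proof.
split=> [/memv_imgP[[u a] _ ->] | [u [a [vl vr]]]].
  exists u, a; split=> j; rewrite lfunE ffunE.
    by rewrite (unsplitK (inl _ j)).
  by rewrite (unsplitK (inr _ j)).
have -> : v = linfun Uphi_map (u, a : {ffun 'I_s -> Fq^o}).
  rewrite lfunE; apply/ffunP => i; rewrite ffunE.
  by case: split_ordP => j -> /=.
exact/memv_img/memvf.
Qed.

Definition Phi : 'M[F]_(s, n0) :=
  \matrix_(i < s, j < n0) phi (vsproj U0 (col_vec G0 j)) i.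

Definition Zmx r (H0 : 'M[F]_(r, n0)) : 'M[F]_(r, s) := - (H0 *m Phi^T).

End Construction.

(* The quotient F^k / W is realised as the complement W^C of W, the class of   *)
(* v being its projection onto W^C along W: by quo_eq0 it vanishes exactly     *)
(* on W.                                                                       *)
Definition quo k (W : {vspace {ffun 'I_k -> F}}) :
  'End({ffun 'I_k -> F}) := daddv_pi (W^C)%VS W.

Lemma quo_eq0 k (W : {vspace {ffun 'I_k -> F}}) v : (quo W v == 0) = (v \in W).
Proof.
have cap0 : (W^C :&: W = 0)%VS by rewrite capvC capv_compl.
have vD : v \in (W^C + W)%VS by rewrite addvC addv_complf memvf.
have := daddv_pi_add cap0 vD; rewrite -/(quo W) => def_v.
apply/eqP/idP => [q0 | Wv].
  by rewrite -def_v q0 add0r memv_pi.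
have id_v := daddv_pi_id (capv_compl W) Wv.
by apply: (addIr v); rewrite add0r -{2}id_v.
Qed.

Definition Ebar k s (W : {vspace {ffun 'I_k -> F}}) (Z : 'M[F]_(k, s)) :
    {vspace {ffun 'I_k -> F}} :=
  span [seq quo W (col_vec Z j) | j <- enum 'I_s].

(* Among the systems U_phi with U_phi extremal h-scattered and                 *)
(* dim Ebar_Z = s there are N pairwise inequivalent ones.                      *)
Definition has_inequivalent h s k0 l n0 (W : {vspace {ffun 'I_(2 * l) -> F}})
    (H0 : 'M[F]_(2 * l, n0)) (G0 : 'M[F]_(k0, n0)) (N : nat) : Prop :=
  exists phi : 'I_N -> 'Hom(subvs_of (colspan G0), {ffun 'I_s -> F}),
    (forall i, extremal_scattered h (Uphi (phi i)) /\
               \dim (Ebar W (Zmx (phi i) H0)) = s) /\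
    (forall i j, i != j -> ~ equivalent (Uphi (phi i)) (Uphi (phi j))).

End Systems.

(* Main.v *)
Require Import Defs.
From HB Require Import structures.
From mathcomp Require Import all_boot all_order all_algebra all_fingroup all_field.
From mathcomp Require Import cyclic boolp ring zify.

Set Implicit Arguments.
Unset Strict Implicit.
Unset Printing Implicit Defensive.

Import Order.TTheory GRing.Theory Num.Theory.
Local Open Scope ring_scope.

(** Two estimates carry the theorem.  Write n = l m, Q = q ^ m and s = (m - 3) / 2,
rounded down.  The dual code of a system with generator matrix G is the
F-space of the row vectors y with G y^T = 0.

- A Gaussian coefficient is at least q ^ (s (n - s)), and this exponent is
  quadratic in m with leading coefficient about (2 l - 1) / 4, hence positive.
  The number of semilinear maps of F ^ (2 l) is at most q to an exponent that is
  linear in m.  This gives the first half of the theorem, and the second half is a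
  pigeonhole argument on the same numbers.

- Every U_phi is extremal (m - 3)-scattered.  Scatteredness is a statement
  about the dual code ([scattered_dual]): if the intersection of U with an
  F-space of dimension h contained h + 1 vectors independent over F_q, an
  F-dependence between them would be a nonzero codeword whose entries span at
  most h + 1 dimensions over F_q.  The generator matrix of U_phi is
  [[G0, 0], [Phi, 1]], and its dual code is generated by [H0 | Z]
  ([ext_kernel]).  So it is enough that the entries of a nonzero codeword
  x H0 span at least m - 1 dimensions over F_q, i.e. that the hyperplane
  orthogonal to x meets W in dimension at most n - m + 1.  This last fact is
  the two-intersection property of maximum scattered systems
  ([dim_cap_hyperplane]): if c(x) is the number of vectors of W in that
  hyperplane, then (Q c(x) - q ^ n) (Q c(x) - q q ^ n) is never negative, and
  its sum over all nonzero x, computed from the first two moments of c,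
  vanishes.

It remains to separate many of these systems.  An equivalence of two systems
induces an F-semilinear map between their duals ([equivalent_dual]), so an
equivalence between U_phi and U_phi' sends W + E_Z to W + E_Z'.  Fix a
complement of W, which has dimension n over F_q.  Its s-dimensional subspaces E
that are graphs over a fixed coordinate subspace number q ^ (s (n - s)); each is
some E_Z, since every Z comes from some phi ([Phi_surj]), and they give
distinct W + E.  A semilinear map is determined by a matrix and by the image of
a generator of the multiplicative group of F ([rmorph_determined]), so at most
Q ^ (4 l ^ 2 + 1) of the W + E are images of any given one, and a greedy choice
([pairwise_unrelated]) yields N pairwise inequivalent systems as soon as
N Q ^ (4 l ^ 2 + 1) < q ^ (s (n - s)). *)

(** * Orthogonality over the large field *)

Section Perp.
Variables (Fq : finFieldType) (F : fieldExtType Fq) (k : nat).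
Local Notation V := {ffun 'I_k -> F}.
Implicit Types (x v w : V) (K : {vspace V}).

Definition dot x v : F := \sum_i x i * v i.

Fact dot_linear x : linear (dot x).
Proof.
move=> c v w; rewrite /dot scaler_sumr -big_split; apply: eq_bigr => i _ /=.
by rewrite !ffunE mulrDr scalerAr.
Qed.

HB.instance Definition _ x := GRing.isLinear.Build Fq _ _ _ (dot x) (dot_linear x).

Definition perp x : {vspace V} := lker (linfun (dot x)).

Lemma memv_perp x v : (v \in perp x) = (dot x v == 0).
Proof. by rewrite memv_ker lfunE. Qed.

Lemma dotC x v : dot x v = dot v x.
Proof. by apply: eq_bigr => i _; rewrite mulrC. Qed.

Definition fscale (b : F) v : V := [ffun i => b * v i].

Lemma dot_fscale b x v : dot x (fscale b v) = b * dot x v.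
Proof. by rewrite /dot mulr_sumr; apply: eq_bigr => i _; rewrite ffunE mulrCA. Qed.

(** On an F-stable subspace a nonzero functional v |-> x . v is onto F, so its
kernel has codimension m over F_q. *)
Lemma dim_cap_perp K x y :
    (forall b v, v \in K -> fscale b v \in K) -> y \in K -> dot x y != 0 ->
  (\dim (K :&: perp x) + \dim {:F})%N = \dim K.
Proof.
move=> Kstable Ky xy; rewrite -(limg_ker_dim (linfun (dot x)) K) -/(perp x).
congr (_ + \dim _)%N; apply/esym/eqP; rewrite eqEsubv subvf; apply/subvP => b _.
have -> : b = linfun (dot x) (fscale (b / dot x y) y).
  by rewrite lfunE /= dot_fscale divfK.
exact/memv_img/Kstable.
Qed.

Lemma dim_ffun : \dim {:V} = (k * \dim {:F})%N.
Proof. by rewrite !dimvf /dim /= card_ord. Qed.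
End Perp.

(** * Counting points of subspaces *)

Section Counting.
Variables (Fq : finFieldType) (F : fieldExtType Fq) (k : nat).
Local Notation V := {ffun 'I_k -> F}.
Local Notation T := (finvect_type {ffun 'I_k -> F}).
Implicit Types (x v w : V) (K : {vspace V}).

Lemma card_subspace K :
  \sum_(x : T) (x \in K)%:R = (#|Fq| ^ \dim K)%:R :> int.
Proof.
have cardK := @card_vspace _ T _ K; rewrite -cardK -sum1_card.
rewrite -natr_sum; congr (_%:R); rewrite [RHS]big_mkcond.
by apply: eq_bigr => x _; case: (x \in K).
Qed.

Lemma sum_two_values (K K' : {vspace V}) (g : V -> int) (a b : int) :
    (K <= K')%VS -> {in K, forall x, g x = a} ->
    (forall x, x \in K' -> x \notin K -> g x = b) ->
  \sum_(x : T) (x \in K')%:R * g x =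
    (#|Fq| ^ \dim K)%:R * a + ((#|Fq| ^ \dim K')%:R - (#|Fq| ^ \dim K)%:R) * b.
Proof.
move=> /subvP sKK' ga gb; rewrite -!card_subspace -sumrB !mulr_suml -big_split.
apply: eq_bigr => x _ /=; case K'x: (x \in K'); case Kx: (x \in K).
- by rewrite ga // subrr mul0r addr0.
- by rewrite (gb x K'x) ?Kx // mul0r add0r subr0.
- by rewrite (sKK' _ Kx) in K'x.
- by rewrite subrr !mul0r addr0.
Qed.

Lemma ffun_neq0 v : v != 0 -> exists i, v i != 0.
Proof.
move=> v0; apply/existsP; apply: contraNT v0; rewrite negb_exists => /forallP v0.
by apply/eqP/ffunP => i; rewrite ffunE; apply/eqP; move: (v0 i); rewrite negbK.
Qed.

Lemma dim_perp v : v != 0 -> (\dim (perp v) + \dim {:F})%N = (k * \dim {:F})%N.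
Proof.
move=> v0; have [i vi] := ffun_neq0 v0.
rewrite -(dim_ffun F k) -(@dim_cap_perp _ _ _ fullv v [ffun j => (j == i)%:R]) //.
- by rewrite capfv.
- by move=> b w _; rewrite memvf.
- exact: memvf.
rewrite /dot (bigD1 i) //= ffunE eqxx mulr1 big1 ?addr0 // => j /negPf ji.
by rewrite ffunE ji mulr0.
Qed.

(** The vector y below is the one of the plane spanned by the coordinates i and
j that is orthogonal to v; it is not orthogonal to w when the minor (i, j) of
(v, w) does not vanish.  Hence w cuts the F-stable space perp v properly. *)
Lemma dim_perp2 v w : v != 0 -> (forall b, w != fscale b v) ->
  (\dim (perp v :&: perp w) + 2 * \dim {:F})%N = (k * \dim {:F})%N.
Proof.
move=> v0 vw; rewrite -(dim_perp v0) mul2n -addnn addnA; congr (_ + _)%N.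
have [i vi] := ffun_neq0 v0.
have [j vwj] : exists j, v i * w j != v j * w i.
  apply/existsP; have := vw (w i / v i); apply: contraNT.
  rewrite negb_exists => /forallP vw0; apply/eqP/ffunP => j.
  have := vw0 j; rewrite negbK ffunE => /eqP vwj; apply: (mulfI vi).
  by rewrite vwj; field.
pose y : V := [ffun l => (l == j)%:R * v i - (l == i)%:R * v j].
have dot_y z : dot z y = z j * v i - z i * v j.
  rewrite /dot (eq_bigr (fun l => (l == j)%:R * (z l * v i) -
                                  (l == i)%:R * (z l * v j))); last first.
    by move=> l _; rewrite ffunE; ring.
  rewrite big_split sumrN /= (bigD1 j) //= eqxx mul1r big1 ?addr0; last first.
    by move=> l /negPf->; rewrite mul0r.
  rewrite (bigD1 i) //= eqxx mul1r big1 ?addr0 //.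
  by move=> l /negPf->; rewrite mul0r.
apply: (@dim_cap_perp _ _ _ (perp v) w y).
- by move=> b z; rewrite !memv_perp dot_fscale => /eqP ->; rewrite mulr0.
- by rewrite memv_perp dot_y mulrC subrr.
by rewrite dot_y subr_eq0 mulrC eq_sym [w i * _]mulrC eq_sym.
Qed.
End Counting.

(** * Hyperplane sections of a maximum scattered system *)

Section HyperplaneIntersections.
Variables (Fq : finFieldType) (F : fieldExtType Fq) (l : nat).
Local Notation V := {ffun 'I_(2 * l) -> F}.
Local Notation T := (finvect_type {ffun 'I_(2 * l) -> F}).
Variable W : {vspace V}.
Hypothesis maxW : maximum_scattered W.
Local Notation m := (\dim {:F}).
Local Notation q := (#|Fq|%:R : int).
Local Notation Q := (q ^+ m).
Local Notation X := (q ^+ (l * m)).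

Let dimW : \dim W = (l * m)%N. Proof. by have [[]] := maxW. Qed.
(** The scattered property is used through this consequence: F-proportional
vectors of W are F_q-proportional. *)
Lemma scattered_vline w w' : w \in W -> w' \in W -> w != 0 ->
  (exists b, w' = fscale b w) -> w' \in <[w]>%VS.
Proof.
move=> Ww Ww' w0 [b w'E].
have [_ /(_ <<rowf w>>%MS)] := maxW.
rewrite mxrank_gen rank_rV.
have -> : (rowf w != 0).
  have [i wi] := ffun_neq0 w0; apply: contraNneq wi => /rowP/(_ i).
  by rewrite !mxE => ->.
move=> /(_ erefl); set L := restr _ => dimL.
have subL : (<[w]> <= W :&: L)%VS.
  by rewrite -memvE memv_cap Ww mem_restr genmxE submx_refl.
have /eqP -> : <[w]>%VS == (W :&: L)%VS by rewrite eqEdim subL dim_vline w0.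
rewrite memv_cap Ww' mem_restr genmxE; apply/submxP; exists b%:M.
by rewrite mul_scalar_mx; apply/rowP => i; rewrite !mxE w'E ffunE.
Qed.

Let section_card (x : V) : int := \sum_(w : T) (w \in W)%:R * (dot x w == 0)%:R.

Lemma section_cardE x : section_card x = q ^+ \dim (W :&: perp x).
Proof.
rewrite -natrX -(card_subspace (W :&: perp x)); apply: eq_bigr => w _.
by rewrite memv_cap memv_perp -natrM mulnb.
Qed.

Hypothesis l_gt0 : (0 < l)%N.
Local Notation P1 := (q ^+ (2 * l * m - m)).
Local Notation P2 := (q ^+ (2 * l * m - 2 * m)).

Let le_2m : (2 * m <= 2 * l * m)%N. Proof. by rewrite -mulnA leq_pmul2l // leq_pmull. Qed.

(** First moment: count the orthogonal pairs (x, w).  The zero vector of W is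
orthogonal to all X ^ 2 vectors x, and each other w to P1 = X ^ 2 / Q of them. *)
Lemma sum_section_card : \sum_(x : T) section_card x = X ^+ 2 + (X - 1) * P1.
Proof.
rewrite /section_card exchange_big /=.
under eq_bigr do rewrite -mulr_sumr.
rewrite (@sum_two_values _ _ _ 0%VS W _ (X ^+ 2) P1) ?sub0v //.
- by rewrite dimv0 dimW expn0 mul1r natrX.
- move=> w; rewrite memv0 => /eqP->.
  rewrite (eq_bigr (fun x => (x \in (fullv : {vspace V}))%:R)); last first.
    by move=> x _; rewrite linear0 eqxx memvf.
  by rewrite card_subspace dim_ffun natrX -exprM -mulnA mulnC mulnAC.
move=> w _; rewrite memv0 => w0.
rewrite (eq_bigr (fun x => (x \in perp w)%:R)); last first.
  by move=> x _; rewrite memv_perp dotC.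
by rewrite card_subspace natrX -(dim_perp w0) addnK.
Qed.

(** Second moment: count the triples (x, w, w') with x orthogonal to w and w'.
For w nonzero, the q multiples of w impose no further condition, and the X - q
other vectors w' are F-independent from w, which leaves P2 = X ^ 2 / Q ^ 2
choices of x. *)
Lemma sum_section_card_sqr : \sum_(x : T) section_card x ^+ 2 =
  X ^+ 2 + (X - 1) * P1 + (X - 1) * (q * P1 + (X - q) * P2).
Proof.
have -> : \sum_(x : T) section_card x ^+ 2 = \sum_(w : T) (w \in W)%:R *
    \sum_(w' : T) (w' \in W)%:R * \sum_(x : T) (x \in perp w :&: perp w')%VS%:R.
  under eq_bigr do rewrite expr2 /section_card mulr_suml.
  rewrite exchange_big; apply: eq_bigr => w _ /=.
  under eq_bigr do rewrite -mulrA mulr_sumr mulr_sumr.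
  rewrite exchange_big mulr_sumr; apply: eq_bigr => w' _ /=.
  rewrite !mulr_sumr; apply: eq_bigr => x _ /=.
  rewrite memv_cap !memv_perp -mulnb natrM (dotC w x) (dotC w' x); ring.
rewrite (@sum_two_values _ _ _ 0%VS W _ (X ^+ 2 + (X - 1) * P1)
  (q * P1 + (X - q) * P2)) ?sub0v //.
- by rewrite dimv0 dimW expn0 mul1r natrX.
- move=> w; rewrite memv0 => /eqP->; rewrite -sum_section_card /section_card exchange_big /=.
  apply: eq_bigr => w' _; rewrite mulr_sumr; apply: eq_bigr => x _.
  by rewrite memv_cap !memv_perp dotC linear0 eqxx dotC.
move=> w Ww; rewrite memv0 => w0.
rewrite (@sum_two_values _ _ _ <[w]>%VS W _ P1 P2).
- by rewrite dim_vline w0 dimW !natrX expr1.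
- by rewrite -memvE.
- move=> w' /vlineP[c ->]; rewrite card_subspace natrX -(dim_perp w0) addnK.
  congr (_ ^+ \dim _); apply/capv_idPl/subvP => x; rewrite !memv_perp.
  by rewrite dotC => /eqP dot0; rewrite dotC linearZ /= dot0 scaler0.
move=> w' Ww' ww'; rewrite card_subspace natrX -(@dim_perp2 _ _ _ w w' w0) ?addnK //.
by move=> b; apply: contraNneq ww' => w'E; apply: scattered_vline => //; exists b.
Qed.

(** The two-intersection argument.  Both possible sizes X / Q and q X / Q of a
section are roots of the quadratic B; a section always has a power of q points,
and at least X / Q, so that no size falls strictly between the two roots and B
is nonnegative.  Its sum over the nonzero x is zero by the moment computations,
so every section has one of the two sizes. *)
Lemma dim_cap_hyperplane (x : V) : x != 0 ->
  (\dim (W :&: perp x) + m <= (l * m).+1)%N.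
Proof.
move=> x0.
have dimWx y : (l * m <= \dim (W :&: perp y) + m)%N.
  rewrite -dimW -{1}(limg_ker_dim (linfun (dot y)) W) leq_add2l.
  exact/dimvS/subvf.
have q1 : 1 < q by rewrite ltr1n finNzRing_gt1.
pose B y := (Q * section_card y - X) * (Q * section_card y - q * X).
have B_ge0 y : 0 <= B y.
  rewrite /B section_cardE -exprD -exprS.
  have := dimWx y; rewrite addnC leq_eqVlt => /predU1P[->|lt].
    by rewrite subrr mul0r.
  by rewrite mulr_ge0 // subr_ge0 ler_eXn2l // ltnW.
have sumB : \sum_(y : T | y != 0) B y = 0.
  have := erefl (\sum_(y : T) B y); rewrite {1}(bigD1 (0 : T)) //=.
  have -> : B 0 = (Q * X - X) * (Q * X - q * X).
    have perp0 : perp (0 : V) = fullv.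
      by apply/vspaceP => v; rewrite memvf memv_perp dotC linear0 eqxx.
    by rewrite /B section_cardE perp0 capvf dimW.
  have -> : \sum_(y : T) B y = Q ^+ 2 * (\sum_(y : T) section_card y ^+ 2)
      - Q * X * (1 + q) * (\sum_(y : T) section_card y) + q * X ^+ 2 * X ^+ 2.
    have cardV : \sum_(y : T) 1 = X ^+ 2.
      rewrite (eq_bigr (fun y => (y \in (fullv : {vspace V}))%:R)).
        by rewrite card_subspace dim_ffun natrX -exprM -mulnA mulnC mulnAC.
      by move=> y _; rewrite memvf.
    rewrite -{2}cardV !mulr_sumr -sumrB -big_split; apply: eq_bigr => y _ /=.
    by rewrite /B; ring.
  have QP1 : Q * P1 = X ^+ 2.
    by rewrite -exprD -exprM subnKC ?(leq_trans _ le_2m) ?leq_pmull //; congr (_ ^+ _); lia.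
  have QP2 : Q * P2 = P1 by rewrite -exprD; congr (_ ^+ _); have := le_2m; lia.
  rewrite sum_section_card_sqr sum_section_card; move: QP1 QP2; set cQ := Q; set cX := X.
  set p1 := P1; set p2 := P2; clearbody cQ cX p1 p2 => QP1 QP2; rewrite -QP2 in QP1 *; move=> eqB.
  apply: (addrI ((cQ * cX - cX) * (cQ * cX - q * cX))); rewrite eqB.
  (* The difference of the two sides is a multiple of Q ^ 2 * P2 - X ^ 2. *)
  apply/eqP; rewrite -subr_eq0; apply/eqP.
  transitivity (((cX - 1) * (cQ + q * cQ + cX - q) - cX * (1 + q) * (cX - 1)) *
                (cQ * (cQ * p2) - cX ^+ 2)); last by rewrite QP1 subrr mulr0.
  by ring.
have : B x == 0.
  by rewrite (psumr_eq0P (fun (y : T) _ => B_ge0 y) sumB).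
rewrite /B mulf_eq0 !subr_eq0 section_cardE -exprD -exprS addnC.
have injX := ieexprIn (lt_trans ltr01 q1) (negbT (gt_eqF q1)).
by case/orP=> /eqP/injX ->.
Qed.

Lemma dim_dot_image (x : V) : x != 0 -> (m <= (\dim (linfun (dot x) @: W)).+1)%N.
Proof.
move=> x0; rewrite -(leq_add2l (\dim (W :&: perp x))) addnS limg_ker_dim dimW.
exact: dim_cap_hyperplane.
Qed.
End HyperplaneIntersections.

(** * Systems as column spans *)

Section ColumnSpans.
Variables (Fq : finFieldType) (F : fieldExtType Fq).

Definition extF m n (c : 'M[Fq]_(m, n)) : 'M[F]_(m, n) := map_mx (in_alg F) c.

Definition colmap k n (A : 'M[F]_(k, n)) (c : 'cV[Fq]_n) : {ffun 'I_k -> F} :=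
  \sum_j c j 0 *: col_vec A j.

Lemma colf_inj k : injective (@colf Fq F k).
Proof.
by move=> u v uv; apply/ffunP => i; move/colP/(_ i): uv; rewrite !mxE.
Qed.

Lemma colf_colmap k n (A : 'M[F]_(k, n)) c : colf (colmap A c) = A *m extF c.
Proof.
apply/colP => i; rewrite !mxE /colmap sum_ffunE; apply: eq_bigr => j _.
by rewrite !ffunE mxE /= mulr_algr.
Qed.

Lemma mem_colspan k n (A : 'M[F]_(k, n)) v :
  v \in colspan A <-> exists c, colf v = A *m extF c.
Proof.
split=> [Av | [c vE]].
  suff [c ->] : exists c, v = colmap A c by exists c; exact: colf_colmap.
  exists (\col_j coord [tuple col_vec A j | j < n] j v).
  rewrite {1}(@coord_span _ _ _ [tuple col_vec A j | j < n] _ Av).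
  by apply: eq_bigr => j _; rewrite mxE -tnth_nth tnth_mktuple.
have -> : v = colmap A c by apply: colf_inj; rewrite colf_colmap.
apply: memv_suml => j _; apply/memvZ/memv_span/map_f; exact: mem_enum.
Qed.

Definition Fq_free k n (A : 'M[F]_(k, n)) :=
  forall c : 'cV[Fq]_n, A *m extF c = 0 -> c = 0.

Lemma Fq_freeP k n (A : 'M[F]_(k, n)) :
  Fq_free A <-> free [seq col_vec A j | j <- enum 'I_n].
Proof.
rewrite -[X in free X]/(val [tuple col_vec A j | j < n]).
have combE (c : 'I_n -> Fq) :
    colf (\sum_(i < n) c i *: [tuple col_vec A j | j < n]`_i) = A *m extF (\col_j c j).
  rewrite -colf_colmap; congr colf; apply: eq_bigr => j _.
  by rewrite mxE -tnth_nth tnth_mktuple.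
split=> [Afree | /freeP Afree c Ac0].
  apply/freeP => c c0 i; have /colP/(_ i) : \col_j c j = 0; last by rewrite !mxE.
  by apply: Afree; rewrite -combE c0; apply/colP => j; rewrite !mxE ffunE.
apply/colP => j; rewrite mxE; apply: (Afree (fun j => c j 0)).
apply: colf_inj; rewrite combE -[RHS](_ : 0 = _); last first.
  by apply/colP => i; rewrite !mxE ffunE.
rewrite -[RHS]Ac0; congr (_ *m extF _); apply/colP => i; by rewrite mxE.
Qed.

Lemma dim_colspan k n (A : 'M[F]_(k, n)) : Fq_free A -> \dim (colspan A) = n.
Proof. by move=> /Fq_freeP/eqP ->; rewrite size_map size_enum_ord. Qed.

Lemma basis_matrix_free k n (W : {vspace {ffun 'I_k -> F}}) (H : 'M[F]_(k, n)) :
  basis_matrix W H -> colspan H = W /\ Fq_free H.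
Proof. by case/andP=> /eqP spanH /Fq_freeP. Qed.

Lemma col_colspan k n (A : 'M[F]_(k, n)) j : col_vec A j \in colspan A.
Proof. by apply/memv_span/map_f; rewrite mem_enum. Qed.

Lemma colf_col_vec k n (A : 'M[F]_(k, n)) j : colf (col_vec A j) = col j A.
Proof. by apply/colP => i; rewrite !mxE ffunE. Qed.

Lemma col_vecK k (z : 'cV[F]_k) : colf (col_vec z 0) = z.
Proof. by rewrite colf_col_vec; apply/colP => i; rewrite mxE. Qed.

Lemma sub_colspan k n1 n2 (A : 'M[F]_(k, n1)) (B : 'M[F]_(k, n2)) :
  (forall j, col_vec B j \in colspan A) <-> exists P, B = A *m extF P.
Proof.
split=> [BA | [P ->] j].
  have /fin_all_exists[c cE] : forall j, exists c, colf (col_vec B j) = A *m extF c.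
    by move=> j; apply/mem_colspan.
  exists (\matrix_(i, j) c j i 0); apply/matrixP => i j.
  move/colP/(_ i): (cE j); rewrite !mxE ffunE => ->.
  by apply: eq_bigr => l _; rewrite !mxE.
apply/mem_colspan; exists (col j P); rewrite colf_col_vec.
by rewrite /extF map_col !colE mulmxA.
Qed.

End ColumnSpans.

(** * Scatteredness and the dual code *)

Section Duality.
Variables (Fq : finFieldType) (F : fieldExtType Fq).

(** The row space of H is the dual code of the code generated by A. *)
Definition kernel_matrix k r n (A : 'M[F]_(k, n)) (H : 'M[F]_(r, n)) :=
  forall y : 'rV[F]_n, A *m y^T = 0 <-> (y <= H)%MS.

Definition rank_weight n (y : 'rV[F]_n) : nat :=
  \dim (span [seq y 0 j | j <- enum 'I_n]).

(** The columns of S are h + 1 vectors of the intersection of the system with L,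
independent over F_q.  They live in an F-space of dimension h, so some lam <> 0
satisfies S lam^T = 0.  As S = A C with C defined over F_q, the vector
y = lam C^T is in the dual code; it is nonzero because C keeps its rank over F,
and its entries are F_q-combinations of the h + 1 entries of lam. *)
Lemma scattered_dual k r n h (A : 'M[F]_(k, n)) (H : 'M[F]_(r, n)) :
    kernel_matrix A H -> Fq_free A ->
    (forall y : 'rV[F]_n, (y <= H)%MS -> y != 0 -> (h.+1 < rank_weight y)%N) ->
  scattered h (colspan A).
Proof.
move=> dualA freeA wtH L rankL; rewrite leqNgt; apply/negP => dimL.
set K := (colspan A :&: restr L)%VS in dimL.
have sizeX : size (take h.+1 (vbasis K)) == h.+1 by rewrite size_takel ?size_tuple.
pose X := Tuple sizeX.
have freeX : free X.
  have := basis_free (vbasisP K); rewrite -{1}(cat_take_drop h.+1 (vbasis K)).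
  exact: catl_free.
have XK i : X`_i \in K.
  have [lti|gei] := ltnP i h.+1; last by rewrite nth_default ?mem0v ?(eqP sizeX).
  by apply/vbasis_mem/(@mem_take h.+1)/mem_nth; rewrite (eqP sizeX).
have /fin_all_exists[c cE] (i : 'I_h.+1) : exists c, colf X`_i = A *m extF F c.
  by apply/mem_colspan; have := XK i; rewrite memv_cap => /andP[].
pose C := \matrix_(i < n, j < h.+1) c j i 0.
pose S := \matrix_(i < k, j < h.+1) X`_j i.
have SE : S = A *m extF F C.
  apply/matrixP => i j; move/colP/(_ i): (cE j); rewrite !mxE => ->.
  by apply: eq_bigr => a _; rewrite !mxE.
have freeC : row_free C^T.
  rewrite -kermx_eq0; apply/rowV0P => v /sub_kermxP vC.
  have /freeP v0 := freeX; apply/rowP => i; rewrite mxE; apply: (v0 (v 0)).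
  apply: colf_inj; transitivity (S *m extF F v^T).
    by apply/colP => a; rewrite !mxE sum_ffunE; apply: eq_bigr => j _;
      rewrite !mxE ffunE /= mulr_algr.
  rewrite SE -mulmxA -map_mxM -[C]trmxK -trmx_mul vC trmx0 /extF map_mx0 mulmx0.
  by apply/colP => a; rewrite !mxE ffunE.
have [lam lam0 lamS] : exists2 lam : 'rV_h.+1, lam != 0 & lam *m S^T = 0.
  have rankS : (\rank S^T <= h)%N.
    apply: leq_trans (mxrankS _) (_ : (\rank L <= h)%N); last by rewrite rankL.
    apply/row_subP => i.
    have -> : row i S^T = rowf X`_i by apply/rowP => j; rewrite !mxE.
    by rewrite -mem_restr; have := XK i; rewrite memv_cap => /andP[].
  have : kermx S^T != 0.
    by rewrite kermx_eq0 /row_free; apply: contraTneq rankS => ->; rewrite -ltnNge.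
  by case/rowV0Pn=> v /sub_kermxP vS v0; exists v.
pose y := lam *m (extF F C)^T.
have yH : (y <= H)%MS.
  apply/dualA; rewrite /y trmx_mul trmxK mulmxA -SE.
  by apply: trmx_inj; rewrite trmx_mul trmxK lamS trmx0.
have y0 : y != 0.
  apply: contraNneq lam0 => y0.
  have /row_freeP[D CD] : row_free (extF F C)^T by rewrite /extF matrix.map_trmx row_free_map.
  by rewrite -[lam]mulmx1 -CD mulmxA -/y y0 mul0mx.
have := wtH y yH y0; rewrite ltnNge => /negP; apply.
have -> : h.+1 = size [seq lam 0 j | j <- enum 'I_h.+1].
  by rewrite size_map size_enum_ord.
apply: leq_trans (dim_span _); apply/dimvS/span_subvP => _ /mapP[j _ ->].
rewrite mxE; apply: memv_suml => i _; rewrite !mxE mulr_algr.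
by apply/memvZ/memv_span/map_f; rewrite mem_enum.
Qed.
End Duality.

(** * Semilinear equivalence and duality *)

Section Semilinear.
Variables (Fq : finFieldType) (F : fieldExtType Fq).

Lemma rmorph_inverse (s : {rmorphism F -> F}) : bijective s ->
  exists t : {rmorphism F -> F}, cancel s t /\ cancel t s.
Proof.
case=> t st ts.
pose t_add := GRing.isZmodMorphism.Build F F t (can2_zmod_morphism st ts).
pose t_mul := GRing.isMonoidMorphism.Build F F t (can2_monoid_morphism st ts).
by exists (HB.pack_for {rmorphism F -> F} t t_add t_mul).
Qed.

(** F_q is the set of roots of x ^ q = x in F, which every field endomorphism
preserves. *)
Lemma rmorph_scalar (s : {rmorphism F -> F}) (c : Fq) :
  exists c' : Fq, s c%:A = c'%:A.
Proof.
apply/vlineP; have in1 (x : F) : (x \in <[1]>%VS) = (x ^+ #|Fq| == x).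
  by rewrite (Fermat's_little_theorem 1%AS) dimv1 expn1.
by rewrite in1 -rmorphXn fmorph_eq -in1 memvZ ?memv_line.
Qed.

Lemma map_extF (s : {rmorphism F -> F}) m n (P : 'M[Fq]_(m, n)) :
  exists P' : 'M[Fq]_(m, n), map_mx s (extF F P) = extF F P'.
Proof.
have /fin_all_exists[P' PE] (ij : 'I_m * 'I_n) :
    exists c' : Fq, s (P ij.1 ij.2)%:A = c'%:A by exact: rmorph_scalar.
exists (\matrix_(i, j) P' (i, j)); apply/matrixP => i j; rewrite !mxE.
exact: (PE (i, j)).
Qed.

Lemma equivalent_sym k (U U' : {vspace {ffun 'I_k -> F}}) :
  equivalent U U' -> equivalent U' U.
Proof.
case=> B [s [uB bijs UU']]; have [t [st ts]] := rmorph_inverse bijs.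
have tsK m n (M : 'M[F]_(m, n)) : map_mx t (map_mx s M) = M.
  by apply/matrixP => i j; rewrite !mxE st.
exists (map_mx t (invmx B)), t; split; first by rewrite map_unitmx unitmx_inv.
  by exists s.
have invE (u u' : {ffun 'I_k -> F}) : colf u' = B *m map_mx s (colf u) ->
    colf u = map_mx t (invmx B) *m map_mx t (colf u').
  by move->; rewrite -map_mxM mulKmx // tsK.
move=> v; split=> [Uv | [u' /UU'[u Uu u'E] vE]].
  pose u' := col_vec (B *m map_mx s (colf v)) 0.
  have u'E : colf u' = B *m map_mx s (colf v).
    exact: col_vecK.
  by exists u'; [apply/UU'; exists v | exact: invE].
by have -> : v = u by apply: colf_inj; rewrite vE (invE _ _ u'E).
Qed.

(** If B s(A) and A' span the same system, then B s(A) = A' M for an invertible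
M over F_q.  Passing to kernels turns this into H' = C s(H) M^T for some C, and
the columns of H' span the same system as those of C s(H). *)
Lemma equivalent_dual k r n (A A' : 'M[F]_(k, n)) (H H' : 'M[F]_(r, n)) :
    kernel_matrix A H -> kernel_matrix A' H' -> Fq_free A ->
    equivalent (colspan A) (colspan A') ->
  exists (C : 'M[F]_r) (s : {rmorphism F -> F}),
    forall v, v \in colspan H' <->
      exists2 u, u \in colspan H & colf v = C *m map_mx s (colf u).
Proof.
move=> kerA kerA' freeA [B [s [uB bijs AA']]]; have [t [st ts]] := rmorph_inverse bijs.
have tsK m1 n1 (M : 'M[F]_(m1, n1)) : map_mx t (map_mx s M) = M.
  by apply/matrixP => i j; rewrite !mxE st.
have stK m1 n1 (M : 'M[F]_(m1, n1)) : map_mx s (map_mx t M) = M.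
  by apply/matrixP => i j; rewrite !mxE ts.
have [M BA] : exists M, B *m map_mx s A = A' *m extF F M.
  apply/sub_colspan => j; apply/AA'; exists (col_vec A j); first exact: col_colspan.
  by rewrite !colf_col_vec map_col !colE mulmxA.
have kersA z : B *m map_mx s A *m z = 0 -> A *m map_mx t z = 0.
  rewrite -mulmxA => /(congr1 (mulmx (invmx B))).
  rewrite mulKmx // mulmx0 => /(congr1 (map_mx t)).
  by rewrite map_mxM tsK map_mx0.
have uM : M \in unitmx.
  rewrite -unitmx_tr -row_free_unit -kermx_eq0; apply/rowV0P => c /sub_kermxP cM; apply: trmx_inj; rewrite trmx0.
  have [c' c'E] := map_extF t c^T.
  have c'0 : c' = 0.
    apply: freeA; rewrite -c'E; apply: kersA; rewrite BA -mulmxA -map_mxM.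
    by rewrite -[M]trmxK -trmx_mul cM trmx0 map_mx0 mulmx0.
  by apply: (@map_mx_inj _ _ (in_alg F)); rewrite -[LHS]stK [map_mx t _]c'E c'0 /extF !map_mx0.
have uMF : extF F M \in unitmx by rewrite map_unitmx.
have /submxP[C CE] : (H' *m (invmx (extF F M))^T <= map_mx s H)%MS.
  apply/row_subP => i; rewrite row_mul.
  have := row_sub i H'; move: (row i H') => y /kerA' yH'.
  rewrite -[X in (X <= _)%MS]stK map_submx; apply/kerA.
  rewrite matrix.map_trmx; apply: kersA.
  by rewrite trmx_mul trmxK BA -mulmxA (mulmxA (extF F M)) mulmxV // mul1mx.
have H'E : H' = C *m map_mx s H *m (extF F M)^T.
  by rewrite -CE -mulmxA -trmx_mul mulmxV // trmx1 mulmx1.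
exists C, s => v; split=> [/mem_colspan[c vE] | [u /mem_colspan[c uE] vE]].
  have [c' c'E] := map_extF t (M^T *m c).
  exists (col_vec (H *m extF F c') 0).
    by apply/mem_colspan; exists c'; rewrite col_vecK.
  rewrite col_vecK.
  rewrite map_mxM -c'E stK vE H'E /extF map_mxM -matrix.map_trmx !mulmxA.
  by [].
apply/mem_colspan; have [c' c'E] := map_extF s c.
exists (invmx M^T *m c'); rewrite vE uE map_mxM c'E H'E -!mulmxA; congr (_ *m (_ *m _)).
rewrite /extF matrix.map_trmx.
by rewrite -map_mxM mulKVmx // unitmx_tr.
Qed.
End Semilinear.

(** * The systems U_phi and their dual codes *)

Section ExtendedSystems.
Variables (Fq : finFieldType) (F : fieldExtType Fq).

(** An F_q-relation between the columns of A is a codeword of the dual code of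
rank weight at most one. *)
Lemma Fq_free_dual k r n (A : 'M[F]_(k, n)) (H : 'M[F]_(r, n)) :
    kernel_matrix A H ->
    (forall y : 'rV[F]_n, (y <= H)%MS -> y != 0 -> (1 < rank_weight y)%N) ->
  Fq_free A.
Proof.
move=> kerA wtH c Ac0; apply/eqP; apply: contraT => c0.
have yH : ((extF F c)^T <= H)%MS by apply/kerA; rewrite trmxK.
have : (extF F c)^T != 0.
  by apply: contra c0 => /eqP/(congr1 trmx); rewrite trmxK trmx0 => /eqP; rewrite map_mx_eq0.
move/(wtH _ yH); rewrite ltnNge => /negP[].
apply: leq_trans (_ : _ <= \dim <[1 : F]>%VS)%N _; last by rewrite dim_vline oner_eq0.
apply/dimvS/span_subvP => _ /mapP[j _ ->]; rewrite !mxE.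
by rewrite memvZ // memv_line.
Qed.

(** Biduality: the row space of H is contained in the kernel of G, and the two
have the same dimension n - k. *)
Lemma dual_generator_kernel k r n (H : 'M[F]_(r, n)) (G : 'M[F]_(k, n)) :
  dual_generator H G -> row_free H -> (k + r)%N = n -> kernel_matrix G H.
Proof.
move=> [freeG GH] freeH krn y.
have kerE : (y <= kermx G^T)%MS <-> G *m y^T = 0.
  by split=> [/sub_kermxP|] Gy; [|apply/sub_kermxP];
    apply: trmx_inj; rewrite trmx_mul ?trmxK Gy trmx0.
have HkerG : (H <= kermx G^T)%MS.
  apply/sub_kermxP/matrixP => i j.
  have /matrixP/(_ 0 0) := (GH (row j G)).1 (row_sub j G) (row i H) (row_sub i H).
  rewrite !mxE => Gij; rewrite -[RHS]Gij.
  by apply: eq_bigr => a _; rewrite !mxE.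
have kerGH : (kermx G^T <= H)%MS.
  rewrite -(mxrank_leqif_sup HkerG) mxrank_ker mxrank_tr.
  by rewrite (eqP freeG) (eqP freeH) -krn addKn.
by rewrite -kerE; split=> [/submx_trans->|yH] //; apply: submx_trans yH HkerG.
Qed.

Lemma mem_Fspan k (U : {vspace {ffun 'I_k -> F}}) u :
  u \in U -> (rowf u <= Fspan U)%MS.
Proof.
move=> /coord_vbasis ->.
have -> : rowf (\sum_(i < \dim U) coord (vbasis U) i u *: (vbasis U)`_i) =
    \sum_(i < \dim U) (coord (vbasis U) i u)%:A *: rowf (vbasis U)`_i.
  apply/rowP => j; rewrite mxE sum_ffunE summxE; apply: eq_bigr => i _.
  by rewrite !mxE ffunE mulr_algl.
apply: summx_sub => i _; apply: scalemx_sub.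
by rewrite -[rowf _](rowK (fun i : 'I_(\dim U) => rowf (vbasis U)`_i)) row_sub.
Qed.

Lemma row_full_Fspan k n (A : 'M[F]_(k, n)) :
  row_full (Fspan (colspan A)) = row_free A.
Proof.
have sA : (A^T <= Fspan (colspan A))%MS.
  apply/row_subP => j; have -> : row j A^T = rowf (col_vec A j).
    by apply/rowP => i; rewrite !mxE ffunE.
  exact/mem_Fspan/col_colspan.
have As : (Fspan (colspan A) <= A^T)%MS.
  apply/row_subP => j; rewrite rowK.
  have /mem_colspan[c cE] : (vbasis (colspan A))`_j \in colspan A.
    by apply/vbasis_mem/mem_nth; rewrite size_tuple.
  have -> : rowf (vbasis (colspan A))`_j = (extF F c)^T *m A^T.
    by rewrite -trmx_mul -cE; apply/rowP => i; rewrite !mxE.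
  exact: submxMl.
have /eqmxP rankA : (Fspan (colspan A) == A^T)%MS by rewrite sA As.
by rewrite /row_full rankA mxrank_tr.
Qed.

Section Extension.
Variables (k s n r : nat) (G : 'M[F]_(k, n)) (H : 'M[F]_(r, n)).
Implicit Type P : 'M[F]_(s, n).

Definition ext_gen P : 'M[F]_(k + s, n + s) := block_mx G 0 P 1%:M.

Lemma Phi_colf (phi : 'Hom(subvs_of (colspan G), {ffun 'I_s -> F})) u c :
  colf (vsval u) = G *m extF F c -> colf (phi u) = Phi phi *m extF F c.
Proof.
move=> uE; have -> : u = \sum_j c j 0 *: vsproj (colspan G) (col_vec G j).
  apply: val_inj; rewrite /= linear_sum /=; apply: colf_inj.
  rewrite uE -colf_colmap; congr colf; apply: eq_bigr => j _.
  by rewrite vsprojK ?col_colspan.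
rewrite linear_sum; apply/colP => i; rewrite !mxE sum_ffunE; apply: eq_bigr => j _.
by rewrite linearZ !mxE ffunE /= mulr_algr.
Qed.

Lemma Uphi_colspan (phi : 'Hom(subvs_of (colspan G), {ffun 'I_s -> F})) :
  Uphi phi = colspan (ext_gen (Phi phi)).
Proof.
have colE (v : {ffun 'I_(k + s) -> F}) : colf v =
    col_mx (\col_i v (lshift s i)) (\col_i v (rshift k i)).
  by rewrite -[LHS]vsubmxK; congr col_mx; apply/colP => i; rewrite !mxE.
have genE c0 c1 : ext_gen (Phi phi) *m extF F (col_mx c0 c1) =
    col_mx (G *m extF F c0) (Phi phi *m extF F c0 + extF F c1).
  by rewrite /extF map_col_mx mul_block_col mul0mx addr0 mul1mx.
apply/vspaceP => v; apply/idP/idP.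
  move=> /mem_Uphi[u [a [vl vr]]]; apply/mem_colspan.
  have /mem_colspan[c uE] := subvsP u.
  exists (col_mx c (\col_i a i)); rewrite genE -uE -(Phi_colf phi uE) colE.
  by congr col_mx; apply/colP => i; rewrite !mxE ?vl ?vr.
move=> /mem_colspan[c]; rewrite -[c]vsubmxK genE colE => /eq_col_mx[vl vr].
apply/mem_Uphi.
have Gc : col_vec (G *m extF F (usubmx c)) 0 \in colspan G.
  by apply/mem_colspan; exists (usubmx c); rewrite col_vecK.
exists (Subvs Gc), [ffun i => dsubmx c i 0]; split=> j /=.
  by rewrite ffunE -vl mxE.
have /colP/(_ j) := vr; rewrite -(@Phi_colf phi (Subvs Gc)) ?col_vecK //.
by rewrite !mxE ffunE => ->; rewrite mxE.
Qed.

(** The columns of G form an F_q-basis of their span, so their images under phi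
can be prescribed. *)
Lemma Phi_surj P : Fq_free G ->
  exists phi : 'Hom(subvs_of (colspan G), {ffun 'I_s -> F}), Phi phi = P.
Proof.
move=> /Fq_freeP freeG.
have [f fE] := linear_of_free [seq col_vec G j | j <- enum 'I_n]
                              [seq col_vec P j | j <- enum 'I_n].
exists (linfun (f \o vsval)); apply/matrixP => i j.
rewrite mxE lfunE /= vsprojK ?col_colspan //.
have := fE freeG; rewrite !size_map => /(_ erefl); rewrite -map_comp.
by move=> /eq_in_map/(_ j (mem_enum _ j)) /= ->; rewrite ffunE.
Qed.

Hypothesis kerGH : kernel_matrix G H.

(** G y^T = 0 forces y = x H, and the second block row of the equation then
expresses the remaining coordinates in terms of x. *)
Lemma ext_kernel P :
  kernel_matrix (ext_gen P) (row_mx H (- (H *m P^T))).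
Proof.
move=> y; rewrite -[y]hsubmxK; move: (lsubmx y) (rsubmx y) => {}y z.
rewrite tr_row_mx mul_block_col mul0mx addr0 mul1mx -col_mx0; split.
  move=> /eq_col_mx[/kerGH/submxP[x ->]] /eqP.
  rewrite addrC addr_eq0 => /eqP/(congr1 trmx); rewrite trmxK => ->.
  apply/submxP; exists x; rewrite mul_mx_row mulmxN; congr row_mx.
  by rewrite linearN /= trmx_mul trmxK mulmxA.
move=> /submxP[x]; rewrite mul_mx_row => /eq_row_mx[-> ->]; congr col_mx.
  by apply/kerGH/submxMl.
by rewrite mulmxN linearN /= !trmx_mul trmxK !mulmxA subrr.
Qed.

Lemma ext_Fq_free P : Fq_free G -> Fq_free (ext_gen P).
Proof.
move=> freeG c; rewrite -[c]vsubmxK /extF map_col_mx mul_block_col -col_mx0.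
move=> /eq_col_mx[]; rewrite mul0mx addr0 mul1mx => /freeG ->.
rewrite map_mx0 mulmx0 add0r -(map_mx0 (in_alg F)) => /map_mx_inj ->.
by rewrite !col_mx0.
Qed.

Lemma ext_row_free P : row_free G -> row_free (ext_gen P).
Proof.
move=> freeG; rewrite -kermx_eq0; apply/rowV0P => y /sub_kermxP.
rewrite -[y]hsubmxK mul_row_block mulmx0 add0r mulmx1 -row_mx0 => /eq_row_mx[yG y0].
move: yG; rewrite y0 mul0mx addr0 => yG.
have /row_freeP[D GD] := freeG.
by rewrite -[lsubmx y]mulmx1 -GD mulmxA yG mul0mx row_mx0.
Qed.
End Extension.
End ExtendedSystems.

(** * Choosing pairwise unrelated elements *)

Section Selection.

(** Greedy choice: by determinism of S each element is related to at most #|C|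
others, so after N choices some element is unrelated to all the chosen ones;
symmetry of r makes one direction sufficient. *)
Lemma pairwise_unrelated (T C : finType) (r : T -> T -> Prop)
    (S : T -> C -> T -> Prop) (N : nat) :
    (forall x y, r x y -> r y x) ->
    (forall x y, r x y -> exists c, S x c y) ->
    (forall x c y y', S x c y -> S x c y' -> y = y') ->
    (N * #|C| < #|T|)%N ->
  exists f : 'I_N -> T, forall i j, i != j -> ~ r (f i) (f j).
Proof.
move=> rC rS SI; elim: N => [|N IHN] ltN.
  by have /card_gt0P[x _] := ltN; exists (fun=> x) => -[].
have [|f fP] := IHN; first by apply: leq_ltn_trans ltN; rewrite leq_mul2r leqnSn orbT.
pose nbrs := \bigcup_(ic : 'I_N * C) [set y | `[< S (f ic.1) ic.2 y >]].
have card_nbrs : (#|nbrs| <= N * #|C|)%N.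
  have -> : (N * #|C| = \sum_(ic : 'I_N * C) 1)%N by rewrite sum1_card card_prod card_ord.
  rewrite /nbrs; elim/big_ind2: _ => [|A a B b Aa Bb|ic _]; first by rewrite cards0.
    by rewrite (leq_trans (leq_card_setU _ _)) ?leq_add.
  apply/card_le1P => y; rewrite inE => /asboolP Sy z; rewrite !inE.
  by apply/asboolP/eqP => [Sz|->//]; apply: SI Sz Sy.
have [x xP] : exists x, x \notin nbrs.
  apply/existsP; rewrite -negb_forall; apply: contraL ltN => /forallP allN.
  rewrite -leqNgt; apply: leq_trans (leq_mul (leqnSn N) (leqnn #|C|)).
  by apply: leq_trans card_nbrs; rewrite subset_leq_card //; apply/subsetP=> y _; apply: allN.
have xf i : ~ r (f i) x.
  move=> /rS[c Sc]; move/bigcupP: xP; apply; exists (i, c) => //.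
  by rewrite inE; apply/asboolP.
exists (fun i => if unlift ord_max i is Some j then f j else x) => i j.
case: (unliftP ord_max i) => [i'|] ->; case: (unliftP ord_max j) => [j'|] -> //=.
- by rewrite (inj_eq lift_inj); exact: fP.
- by move=> _ /rC/xf.
by rewrite eqxx.
Qed.

(** The element g generates the cyclic multiplicative group of F.  Bounding the
automorphisms by the choices of an image of g avoids determining them all. *)
Lemma rmorph_determined (Fq : finFieldType) (F : fieldExtType Fq) :
  exists g : F, forall s t : {rmorphism F -> F}, s g = t g -> s =1 t.
Proof.
have /cyclicP[u uE] := field_unit_group_cyclic [set: {unit finvect_type F}].
exists (val u : F) => s t stu x.
have [->|x0] := eqVneq x 0; first by rewrite !rmorph0.
have ux : (x : finvect_type F) \is a GRing.unit by rewrite unitfE.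
have : FinRing.unit _ ux \in <[u]>%g by rewrite -uE inE.
case/cycleP=> i /(congr1 val); rewrite FinRing.val_unitX /= => ->.
by rewrite !rmorphXn /= stu.
Qed.
End Selection.

(** * Many inequivalent systems over a fixed field *)

Section Families.
Variables (Fq : finFieldType) (F : fieldExtType Fq).

Lemma Fq_free_mulmx k n p (A : 'M[F]_(k, n)) (P : 'M[Fq]_(n, p)) :
  Fq_free A -> A *m extF F P = 0 -> P = 0.
Proof.
move=> freeA AP; apply/matrixP => i j; rewrite mxE.
suff /colP/(_ i) : col j P = 0 by rewrite !mxE.
by apply: freeA; rewrite /extF map_col colE mulmxA AP mul0mx.
Qed.

Lemma basis_matrix_exists k n (U : {vspace {ffun 'I_k -> F}}) :
  \dim U = n -> exists B : 'M[F]_(k, n), basis_matrix U B.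
Proof.
move=> <-; exists (\matrix_(i < k, j < \dim U) (vbasis U)`_j i).
rewrite /basis_matrix (_ : map _ _ = vbasis U) ?vbasisP //.
apply: (@eq_from_nth _ 0); rewrite size_map size_enum_ord ?size_tuple // => j ltj.
rewrite (nth_map (Ordinal ltj)) ?size_enum_ord //; apply/ffunP => i.
by rewrite ffunE mxE nth_enum_ord.
Qed.

(** The column spaces of the matrices col_mx 1 M are the graphs of the linear
maps M, and a graph determines its map.  The dimension n is kept abstract, with
an equation, to avoid casts when n is not syntactically a sum. *)
Lemma graph_matrices n s t : n = (s + t)%N ->
  exists graph : 'M[Fq]_(t, s) -> 'M[Fq]_(n, s),
    (forall M (c : 'cV_s), graph M *m c = 0 -> c = 0) /\
    (forall M M' Q, graph M = graph M' *m Q -> M = M').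
Proof.
move=> ->; exists (fun M => col_mx 1%:M M); split=> [M c|M M' Q].
  by rewrite mul_col_mx mul1mx -col_mx0 => /eq_col_mx[].
by rewrite mul_col_mx mul1mx => /eq_col_mx[<-]; rewrite mulmx1.
Qed.

Lemma dim_Ebar k s (W : {vspace {ffun 'I_k -> F}}) (Z : 'M[F]_(k, s)) :
  (colspan Z <= W^C)%VS -> \dim (Ebar W Z) = \dim (colspan Z).
Proof.
move=> /subvP ZW; congr (\dim (span _)); apply: eq_map => j.
by apply: daddv_pi_id; [rewrite capvC capv_compl | apply/ZW/col_colspan].
Qed.

Lemma leq_rank_weight_row_mx n s (y : 'rV[F]_n) (z : 'rV[F]_s) :
  (rank_weight y <= rank_weight (row_mx y z))%N.
Proof.
apply/dimvS/span_subvP => _ /mapP[j _ ->].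
by rewrite -(row_mxEl y z); apply/memv_span/map_f; rewrite mem_enum.
Qed.

End Families.

Section FixedExtension.
Variables (Fq : finFieldType) (F : fieldExtType Fq) (l m n k s : nat).
Hypothesis dimF : \dim {:F} = m.
Variables (W : {vspace {ffun 'I_(2 * l) -> F}}).
Variables (H0 : 'M[F]_(2 * l, n)) (G0 : 'M[F]_(k, n)).
Hypotheses (l_gt0 : (0 < l)%N) (m_ge5 : (5 <= m)%N) (nE : n = (l * m)%N).
Hypotheses (kE : k = (l * (m - 2))%N) (s_le : (2 * s <= m - 3)%N).
Hypotheses (maxW : maximum_scattered W) (basW : basis_matrix W H0).
Hypothesis dualG : dual_generator H0 G0.

Let spanH0 : colspan H0 = W. Proof. by have [] := basis_matrix_free basW. Qed.
Let freeH0 : Fq_free H0. Proof. by have [] := basis_matrix_free basW. Qed.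

Let row_freeH0 : row_free H0.
Proof. by rewrite -row_full_Fspan spanH0; have [[]] := maxW. Qed.

Let kerG : kernel_matrix G0 H0.
Proof. by apply: dual_generator_kernel => //; rewrite kE nE; nia. Qed.

Lemma rank_weight_maximum (x : 'rV[F]_(2 * l)) :
  x != 0 -> (m <= (rank_weight (x *m H0)).+1)%N.
Proof.
move=> x0; pose x' : {ffun 'I_(2 * l) -> F} := [ffun i => x 0 i].
have x'0 : x' != 0.
  apply: contraNneq x0 => /ffunP x'0; apply/eqP/rowP => i.
  by have := x'0 i; rewrite !ffunE mxE.
have := dim_dot_image maxW l_gt0 x'0; rewrite dimF -spanH0 limg_span -map_comp.
rewrite /rank_weight (@eq_map _ _ _ (fun j => (x *m H0) 0 j)) // => j.
by rewrite /= lfunE /= /dot mxE; apply: eq_bigr => i _; rewrite !ffunE.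
Qed.

(** Appending the columns of Z can only increase the rank weight, so the bound
for W holds for the dual codes of all the extended systems. *)
Lemma rank_weight_extension (Z : 'M[F]_(2 * l, s)) y :
  (y <= row_mx H0 Z)%MS -> y != 0 -> (m <= (rank_weight y).+1)%N.
Proof.
move=> /submxP[x ->]; have [-> | x0 _] := eqVneq x 0; first by rewrite mul0mx eqxx.
rewrite mul_mx_row (leq_trans (rank_weight_maximum x0)) //.
by rewrite ltnS leq_rank_weight_row_mx.
Qed.

Let freeG0 : Fq_free G0.
Proof.
apply: (Fq_free_dual kerG) => y /submxP[x ->].
have [-> | x0 _] := eqVneq x 0; first by rewrite mul0mx eqxx.
rewrite -ltnS; apply: leq_trans (rank_weight_maximum x0); lia.
Qed.

Lemma Uphi_extremal (phi : 'Hom(subvs_of (colspan G0), {ffun 'I_s -> F})) :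
  extremal_scattered (m - 3) (Uphi phi).
Proof.
have freeE : Fq_free (ext_gen G0 (Phi phi)) by exact: ext_Fq_free.
rewrite Uphi_colspan; split; first split.
- rewrite dim_colspan // dimF nE kE (_ : (m - 3).+1 = m - 2)%N; last by lia.
  have -> : ((l * (m - 2) + s) * m = (l * m + s) * (m - 2) + 2 * s)%N by nia.
  by rewrite divnMDl ?divn_small ?addn0 //; lia.
- by rewrite row_full_Fspan ext_row_free //; have [] := dualG.
apply: scattered_dual (ext_kernel kerG _) freeE _ => y yH y0.
rewrite -ltnS; apply: leq_trans (rank_weight_extension yH y0); lia.
Qed.

(** The indices are the matrices M over F_q of size (n - s) x s, standing for the
graphs E_M in the complement of W.  An equivalence between U_phi(M) and
U_phi(M') makes the span of [H0 | Z M'] the image of that of [H0 | Z M] under a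
semilinear map, coded by its matrix and the image of g; so M and the code
determine M'. *)
Lemma many_inequivalent N :
  (N * #|Fq| ^ (m * (2 * l * (2 * l)) + m) < #|Fq| ^ (s * (n - s)))%N ->
  has_inequivalent (m - 3) s W H0 G0 N.
Proof.
move=> ltN.
have dimW : \dim W = n by rewrite -spanH0 dim_colspan.
have [B basB] : exists B : 'M[F]_(2 * l, n), basis_matrix (W^C)%VS B.
  by apply: basis_matrix_exists; rewrite dimv_compl dim_ffun dimW dimF nE; lia.
have [spanB freeB] := basis_matrix_free basB.
(* The columns of H0 and B together are an F_q-basis of F ^ (2 l). *)
have freeHB p (P Q : 'M[Fq]_(n, p)) : H0 *m extF F P = B *m extF F Q -> Q = 0.
  move=> HPBQ; apply: (Fq_free_mulmx freeB); apply/matrixP => i j.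
  have [W1 W2] : col_vec (H0 *m extF F P) j \in W /\ col_vec (H0 *m extF F P) j \in (W^C)%VS.
    split; first by rewrite -spanH0; move: j; apply/sub_colspan; exists P.
    by rewrite HPBQ -spanB; move: j; apply/sub_colspan; exists Q.
  have : col_vec (H0 *m extF F P) j \in (W :&: W^C)%VS by rewrite memv_cap W1.
  by rewrite capv_compl memv0 HPBQ => /eqP/ffunP/(_ i); rewrite !ffunE => ->; rewrite mxE.
have [|graph [graph_inj graph_neq]] := @graph_matrices Fq n s (n - s).
  by rewrite subnKC // nE; nia.
pose Z M := B *m extF F (graph M).
have /fin_all_exists[phi phiE] (M : 'M[Fq]_(n - s, s)) :
    exists phi : 'Hom(subvs_of (colspan G0), {ffun 'I_s -> F}), Zmx phi H0 = Z M.
  have /row_freeP[D HD] := row_freeH0.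
  have [phi phiE] := Phi_surj (- (D *m Z M))^T freeG0; exists phi.
  by rewrite /Zmx phiE trmxK mulmxN opprK mulmxA HD mul1mx.
have dimE M : \dim (Ebar W (Zmx (phi M) H0)) = s.
  rewrite phiE dim_Ebar.
    apply: dim_colspan => c; rewrite /Z -mulmxA -map_mxM => /freeB; exact: graph_inj.
  apply/span_subvP => _ /mapP[j _ ->]; rewrite -spanB.
  by move: j; apply/sub_colspan; exists (graph M).
have kerU M := ext_kernel kerG (Phi (phi M)).
have colsZ M : - (H0 *m (Phi (phi M))^T) = Z M by exact: phiE.
have [g gP] := rmorph_determined F.
pose S M (c : 'M[finvect_type F]_(2 * l) * finvect_type F) M' :=
  exists2 t : {rmorphism F -> F}, t g = c.2 &
    forall v, v \in colspan (row_mx H0 (Z M')) <->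
      exists2 u, u \in colspan (row_mx H0 (Z M)) & colf v = (c.1 : 'M[F]__) *m map_mx t (colf u).
have [] := @pairwise_unrelated _ _ (fun M M' => equivalent (Uphi (phi M)) (Uphi (phi M')))
  S N (fun _ _ => @equivalent_sym _ _ _ _ _).
- move=> M M'; rewrite !Uphi_colspan => /equivalent_dual.
  move=> /(_ _ _ _ (kerU M) (kerU M') (ext_Fq_free freeG0)).
  by rewrite !colsZ => -[C [t tP]]; exists (C, t g); exists t.
- move=> M c M1 M2 [t1 t1g S1] [t2 t2g S2].
  have t12 : t1 =1 t2 by apply: gP; rewrite t1g.
  have span12 : colspan (row_mx H0 (Z M1)) = colspan (row_mx H0 (Z M2)).
    apply/vspaceP => v; apply/idP/idP => [/S1[u Uu vE] | /S2[u Uu vE]];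
      [apply/S2 | apply/S1]; exists u => //; rewrite vE; congr (_ *m _);
      by apply: eq_map_mx => x; rewrite t12.
  have [Q ZQ] : exists Q, Z M1 = row_mx H0 (Z M2) *m extF F Q.
    apply/sub_colspan => j; rewrite -span12.
    have -> : col_vec (Z M1) j = col_vec (row_mx H0 (Z M1)) (rshift n j).
      by apply/ffunP => i; rewrite !ffunE row_mxEr.
    exact: col_colspan.
  apply: (graph_neq _ _ (dsubmx Q)).
  apply/eqP; rewrite -subr_eq0; apply/eqP.
  apply: (freeHB _ (usubmx Q)).
  move: ZQ; rewrite -{1}[Q]vsubmxK /Z /extF map_col_mx mul_row_col.
  rewrite map_mxB mulmxBr map_mxM mulmxA => ->; by rewrite addrK.
- have cardF : #|{: finvect_type F}| = (#|Fq| ^ m)%N.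
    by rewrite -dimF -(@card_vspace Fq (finvect_type F)) card_vspacef.
  by rewrite card_prod !card_mx cardF -!expnM -expnD [((n - s) * s)%N]mulnC.
move=> f fP; exists (phi \o f); split=> [i | i j ij]; last exact: fP.
by split; [exact: Uphi_extremal | exact: dimE].
Qed.
End FixedExtension.

(** * Growth of Gaussian coefficients *)

Section Asymptotics.

(** Each of the s factors is at least q ^ (N - s). *)
Lemma gauss_binomial_ge q N s : (1 < q)%N -> (s <= N)%N ->
  (q ^ (s * (N - s)))%:R <= gauss_binomial q N s.
Proof.
move=> q_gt1 le_sN; rewrite mulnC expnM natrX -[s in _ ^+ s]card_ord -prodr_const.
apply: ler_prod => i _; rewrite ler0n /=.
have q_gt0 := ltnW q_gt1.
rewrite ler_pdivlMr; last first.
  by rewrite subr_gt0 ltr1n -{1}(expn0 q) ltn_exp2l ?subn_gt0.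
rewrite (_ : N - i = (N - s) + (s - i))%N; last by have := ltn_ord i; lia.
by rewrite expnD natrM mulrBr mulr1 lerB // ler1n expn_gt0 q_gt0.
Qed.

(** For m >= 4 K + 5 both 2 K <= s_ m and m <= 2 (l m - s_ m) hold. *)
Lemma exponent_growth l K m : (0 < l)%N -> (4 * K + 5 <= m)%N ->
  (K * m <= s_ m * (l * m - s_ m))%N.
Proof.
move=> l_gt0 le_m; rewrite /s_.
have sK : (2 * K <= (m - 3) %/ 2)%N by lia.
have s_le : (m <= 2 * (l * m - (m - 3) %/ 2))%N.
  have : (m <= l * m)%N by rewrite leq_pmull.
  by lia.
move: sK s_le; set s := (_ %/ 2)%N; set d := (_ - s)%N; nia.
Qed.

Lemma card_GL_le (Fq : finFieldType) (F : fieldExtType Fq) n : (0 < n)%N ->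
  (#|'GL_n[finvect_type F]%g| <= #|Fq| ^ (\dim {:F} * (n * n)))%N.
Proof.
case: n => // n _; have cardF : #|{: finvect_type F}| = (#|Fq| ^ \dim {:F})%N.
  by rewrite -(@card_vspace Fq (finvect_type F)) card_vspacef.
rewrite expnM -cardF -card_mx cardsT.
exact: (leq_card _ val_inj).
Qed.
End Asymptotics.

(** * Letting the extension degree grow *)

Theorem corollary3p4 (p e l : nat) (hp : prime p) (he : (0 < e)%N)
    (hl : (1 <= l)%N) (Fq : finFieldType) (hFq : #|Fq| = (p ^ e)%N)
    (F : nat -> fieldExtType Fq)
    (hF : forall m : nat, (5 <= m)%N -> \dim {:F m} = m) :
  tends_to_infty (fun m : nat =>
    Num.ceil (gauss_binomial (p ^ e) (l * m) (s_ m) /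
              (e * m * #|'GL_(2 * l)[finvect_type (F m)]%g|)%:R))
  /\
  (forall (W : forall m : nat, {vspace {ffun 'I_(2 * l) -> F m}})
          (H0 : forall m : nat, 'M[F m]_(2 * l, l * m))
          (G0 : forall m : nat, 'M[F m]_(l * (m - 2), l * m)),
     (forall m : nat, (5 <= m)%N ->
        [/\ maximum_scattered (W m), basis_matrix (W m) (H0 m)
          & dual_generator (H0 m) (G0 m)]) ->
     forall N : nat, exists m0 : nat, forall m : nat, (m0 <= m)%N ->
       has_inequivalent (m - 3) (s_ m) (W m) (H0 m) (G0 m) N).
Proof.
have q_gt1 : (1 < p ^ e)%N by rewrite -hFq finNzRing_gt1.
pose r := (2 * l * (2 * l))%N; pose m0 N := (4 * (r + 2 + N) + 5)%N.
(* The exponent m r bounds the order of GL, the term m absorbs the factor m or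
   the choice of an automorphism, N absorbs N <= q ^ N, and 1 absorbs e <= q. *)
have growth N m : (m0 N <= m)%N ->
    (m * r + m + N + 1 <= s_ m * (l * m - s_ m))%N.
  move=> le_m; apply: leq_trans (exponent_growth hl le_m).
  have : (5 <= m)%N by rewrite (leq_trans _ le_m) // leq_addl.
  rewrite !mulnDl; nia.
have m_ge5 N m : (m0 N <= m)%N -> (5 <= m)%N by apply: leq_trans; rewrite leq_addl.
split=> [B | W H0 G0 WHG N].
  exists (m0 `|B|%N) => m le_m; have m5 := m_ge5 _ _ le_m.
  set g := #|_|.
  have g_le : (g <= (p ^ e) ^ (m * r))%N.
    have := @card_GL_le Fq (F m) (2 * l); rewrite hF // hFq; apply.
    by rewrite muln_gt0.
  have g_gt0 : (0 < g)%N by exact: cardG_gt0.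
  rewrite -(ler_int rat); apply: le_trans (ceil_ge _).
  apply: le_trans (_ : `|B|%N%:~R <= _); first by rewrite ler_int abszE ler_norm.
  rewrite ler_pdivlMr ?ltr0n ?muln_gt0 ?he ?g_gt0 ?(leq_trans _ m5) //.
  apply: le_trans (gauss_binomial_ge q_gt1 _); last by rewrite /s_; nia.
  rewrite -pmulrn -natrM ler_nat.
  apply: leq_trans (leq_pexp2l (ltnW q_gt1) (growth _ _ le_m)).
  have e_le : (e <= (p ^ e) ^ 1)%N by rewrite expn1 ltnW // ltn_expl // prime_gt1.
  rewrite [X in (X <= _)%N](_ : _ = g * m * `|B|%N * e)%N; last by lia.
  by rewrite !expnD !leq_mul // ltnW // ltn_expl.
exists (m0 N) => m le_m; have m5 := m_ge5 _ _ le_m.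
have [maxW basW dualG] := WHG m m5.
apply: (many_inequivalent (hF m m5)) => //.
  by rewrite /s_; lia.
rewrite hFq; apply: leq_trans (leq_pexp2l (ltnW q_gt1) (growth _ _ le_m)).
rewrite -/r -(addnA (m * r + m)%N) [X in (_ < X)%N]expnD mulnC ltn_pmul2l ?expn_gt0 ?prime_gt0 //.
by rewrite (leq_trans (ltn_expl N q_gt1)) // leq_pexp2l ?leq_addr // ltnW.
Qed.
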